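(* Let $A=\Pi_Q(k)$ with $Q=\widetilde{A_{n-1}}$ and let $g$ be a graded automorphism of $A$ (of not necessarily finite order) with $g(e_i)=e_i$ for all $i=1,\dots,n$; write $g(\alpha_i)=c_i\alpha_i$ and $g(\alpha_i^\ast)=t_i\alpha_i^\ast$. Then the vector trace equals $$\underline{\operatorname{Tr}}_A(g,t)=M^{-1}\begin{pmatrix}1\\ \vdots\\ 1\end{pmatrix},$$ where $M$ is the $n\times n$ matrix with $M_{ii}=1+c_1t_1t^2$ for $1\le i\le n$, $M_{i,i+1}=-c_it$ and $M_{i+1,i}=-t_it$ for $1\le i\le n-1$, $M_{n,1}=-c_nt$, $M_{1,n}=-t_nt$, and all other entries $0$.
   Context: $k$ is an algebraically closed field of characteristic $0$. Let $n\ge 3$ and let $Q=\widetilde{A_{n-1}}$ be the quiver with vertices $e_1,\dots,e_n$ and one arrow $\alpha_i$ from $e_i$ to $e_{i+1}$ for each $i=1,\dots,n$ (indices modulo $n$). Its double $\bar Q$ has the same vertices, the arrows $\alpha_i$, and additional arrows $\alpha_i^\ast$ from $e_{i+1}$ to $e_i$. Paths are composed left to right, and $e_i$ also denotes the trivial path at the vertex $e_i$. The preprojective algebra is $A=\Pi_Q(k)=k\bar Q/\left(\sum_i\alpha_i\alpha_i^\ast-\sum_i\alpha_i^\ast\alpha_i\right)$, i.e. $k\bar Q$ modulo the relations $\alpha_i\alpha_i^\ast=\alpha_{i-1}^\ast\alpha_{i-1}$, graded by path length. A graded automorphism is an algebra automorphism $g$ with $g(A_j)=A_j$ for all $j$.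 If $g(e_i)=e_i$ for all $i$ then necessarily $g(\alpha_i)=c_i\alpha_i$, $g(\alpha_i^\ast)=t_i\alpha_i^\ast$ for nonzero scalars with $c_it_i=c_1t_1$ for all $i$. The vector trace $\underline{\operatorname{Tr}}_A(g,t)$ is the column vector of formal power series with $j$-th entry $\sum_{s\ge0}\operatorname{tr}(g|_{e_jA_s})t^s$, $j=1,\dots,n$. *)

(* Defs.v *)
(* MathComp, with the classical axioms of mathcomp.classical.boolp. *)
From HB Require Import structures.
From mathcomp Require Import all_boot all_order all_algebra.
From mathcomp Require Import generic_quotient ring_quotient finmap monalg.
From mathcomp Require Import boolp classical_sets.

Set Implicit Arguments.
Unset Strict Implicit.
Unset Printing Implicit Defensive.

Import GRing.Theory.
Local Open Scope ring_scope.
Local Open Scope quotient_scope.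
Local Open Scope classical_set_scope.

(* The field [qpoint] says that there is at least one vertex; without it the
   path algebra would be the zero ring, which is not a [nzRingType]. *)
Record quiver := Quiver {
  qvertex : finType;
  qarrow : finType;
  qsrc : qarrow -> qvertex;
  qtgt : qarrow -> qvertex;
  qpoint : qvertex }.

Fixpoint is_walk (Q : quiver) (v : qvertex Q) (s : seq (qarrow Q)) : bool :=
  if s is a :: s' then (qsrc a == v) && is_walk (qtgt a) s' else true.

Definition walk_end (Q : quiver) (v : qvertex Q) (s : seq (qarrow Q)) :=
  last v (map (@qtgt Q) s).

Lemma is_walk_cat (Q : quiver) (v : qvertex Q) (s1 s2 : seq (qarrow Q)) :
  is_walk v (s1 ++ s2) = is_walk v s1 && is_walk (walk_end v s1) s2.
Proof. by elim: s1 v => //= a s1 IH v; rewrite IH andbA. Qed.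

Lemma walk_end_cat (Q : quiver) (v : qvertex Q) (s1 s2 : seq (qarrow Q)) :
  walk_end v (s1 ++ s2) = walk_end (walk_end v s1) s2.
Proof. by rewrite /walk_end map_cat last_cat. Qed.

(* A path is its source together with the list of its arrows, read from left
   to right; [(v, [::])] is the trivial path at [v]. *)
Definition qpath (Q : quiver) :=
  {p : qvertex Q * seq (qarrow Q) | is_walk p.1 p.2}.

HB.instance Definition _ (Q : quiver) := Choice.on (qpath Q).

Section Paths.
Variable Q : quiver.
Implicit Types p q r : qpath Q.

Definition psource p : qvertex Q := (val p).1.
Definition parrows p : seq (qarrow Q) := (val p).2.
Definition ptarget p : qvertex Q := walk_end (psource p) (parrows p).
Definition plength p : nat := size (parrows p).

Definition ptriv (v : qvertex Q) : qpath Q :=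
  exist (fun p : qvertex Q * seq (qarrow Q) => is_walk p.1 p.2) (v, [::]) isT.

Fact parrow_subproof (a : qarrow Q) : is_walk (qsrc a) [:: a].
Proof. by rewrite /= eqxx. Qed.

Definition parrow (a : qarrow Q) : qpath Q :=
  exist (fun p : qvertex Q * seq (qarrow Q) => is_walk p.1 p.2)
    (qsrc a, [:: a]) (parrow_subproof a).

Definition pcomposable p q := ptarget p == psource q.

(* Only meaningful when [pcomposable p q]; the default value [p] is never
   reached in that case, see [val_pcat]. *)
Definition pcat p q : qpath Q :=
  insubd p (psource p, parrows p ++ parrows q).

Lemma val_pcat p q : pcomposable p q ->
  val (pcat p q) = (psource p, parrows p ++ parrows q).
Proof.
move=> /eqP cpq; rewrite /pcat val_insubd /= is_walk_cat.
by rewrite (valP p : is_walk _ _) -/(ptarget p) cpq (valP q : is_walk _ _).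
Qed.

Lemma psource_cat p q : pcomposable p q -> psource (pcat p q) = psource p.
Proof. by rewrite /psource => /val_pcat ->. Qed.

Lemma ptarget_cat p q : pcomposable p q -> ptarget (pcat p q) = ptarget q.
Proof.
move=> cpq; rewrite /ptarget /psource /parrows (val_pcat cpq) /=.
by rewrite walk_end_cat -/(ptarget p) (eqP cpq).
Qed.

Lemma pcatA p q r : pcomposable p q -> pcomposable q r ->
  pcat p (pcat q r) = pcat (pcat p q) r.
Proof.
move=> cpq cqr; apply: val_inj; rewrite !val_pcat //.
- by rewrite /psource /parrows !val_pcat //= catA.
- by rewrite /pcomposable ptarget_cat.
- by rewrite /pcomposable psource_cat.
Qed.

Lemma pcat1p v q : v = psource q -> pcat (ptriv v) q = q.
Proof.
move=> ->; apply: val_inj; rewrite val_pcat; last by rewrite /pcomposable /=.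
by case: q => -[].
Qed.

Lemma pcatp1 v p : ptarget p = v -> pcat p (ptriv v) = p.
Proof.
move=> <-; apply: val_inj; rewrite val_pcat ?/pcomposable //=.
by rewrite /parrows /= cats0; case: p => -[].
Qed.

End Paths.

Definition path_algebra (k : fieldType) (Q : quiver) := {malg k[qpath Q]}.

HB.instance Definition _ (k : fieldType) (Q : quiver) :=
  GRing.Lmodule.on (path_algebra k Q).

Lemma bilinear_assoc (k : fieldType) (V : lmodType k) (m : V -> V -> V)
    (I : Type) (b : I -> V) :
  left_distributive m +%R -> right_distributive m +%R ->
  (forall a x y, a *: m x y = m (a *: x) y) ->
  (forall a x y, a *: m x y = m x (a *: y)) ->
  (forall P : V -> Prop, P 0 -> (forall x y, P x -> P y -> P (x + y)) ->
    (forall a x, P x -> P (a *: x)) -> (forall i, P (b i)) ->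
    forall x, P x) ->
  (forall i j l, m (b i) (m (b j) (b l)) = m (m (b i) (b j)) (b l)) ->
  associative m.
Proof.
move=> mDl mDr mZl mZr ind bA.
have m0l x : m 0 x = 0 by have := mZl 0 0 x; rewrite !scale0r.
have m0r x : m x 0 = 0 by have := mZr 0 x 0; rewrite !scale0r.
move=> x y z; move: x; apply: (ind) => [|x1 x2 e1 e2|a x e|i].
- by rewrite !m0l.
- by rewrite !mDl e1 e2.
- by rewrite -!mZl e.
move: y; apply: (ind) => [|x1 x2 e1 e2|a x e|j].
- by rewrite m0l m0r m0l.
- by rewrite mDl !mDr mDl e1 e2.
- by rewrite -mZl -!mZr -mZl e.
move: z; apply: (ind) => [|x1 x2 e1 e2|a x e|l]; last exact: bA.
- by rewrite !m0r.
- by rewrite !mDr e1 e2.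
- by rewrite -!mZr e.
Qed.

(* [pa_path] and [pa_mul] are locked to keep unification from unfolding them. *)
HB.lock Definition pa_path (k : fieldType) (Q : quiver) (p : qpath Q) :
  path_algebra k Q := << p >>%R.

Lemma pa_pathE (k : fieldType) (Q : quiver) (p : qpath Q) :
  pa_path k p = << p >>%R.
Proof. by rewrite pa_path.unlock. Qed.

Definition pa_mulpath (k : fieldType) (Q : quiver) (p q : qpath Q) :
    path_algebra k Q :=
  if pcomposable p q then pa_path k (pcat p q) else 0.

HB.lock Definition pa_mul (k : fieldType) (Q : quiver) (x y : path_algebra k Q) :
    path_algebra k Q :=
  \sum_(p <- msupp x) \sum_(q <- msupp y)
    (mcoeff p x * mcoeff q y) *: pa_mulpath k p q.

Section PathAlgebra.
Variables (k : fieldType) (Q : quiver).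
Local Notation kQ := (path_algebra k Q).
Local Notation pa_path := (@pa_path k Q).
Local Notation pa_mulpath := (@pa_mulpath k Q).
Local Notation pa_mul := (@pa_mul k Q).
Implicit Types (x y z : kQ) (p q r : qpath Q).

Definition pa_one : kQ := \sum_(v : qvertex Q) pa_path (ptriv v).

Lemma pa_mulw (d1 d2 : {fset qpath Q}) x y :
  (msupp x `<=` d1)%fset -> (msupp y `<=` d2)%fset ->
  pa_mul x y = \sum_(p <- d1) \sum_(q <- d2)
    (mcoeff p x * mcoeff q y) *: pa_mulpath p q.
Proof.
move=> le1 le2; rewrite pa_mul.unlock (big_fset_incl _ le1) /=.
  apply/eq_bigr => p _; apply/big_fset_incl => // q _ /mcoeff_outdom ->.
  by rewrite mulr0 scale0r.
by move=> p _ /mcoeff_outdom xp; rewrite big1 // => q _; rewrite xp mul0r scale0r.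
Qed.

Lemma pa_mulDl : left_distributive pa_mul +%R.
Proof.
move=> x y z.
rewrite (pa_mulw (msuppD_le x y) (fsubset_refl _)).
rewrite (pa_mulw (fsubsetUl (msupp x) (msupp y)) (fsubset_refl _)).
rewrite (pa_mulw (fsubsetUr (msupp x) (msupp y)) (fsubset_refl _)).
rewrite -big_split; apply: eq_bigr => p _; rewrite -big_split.
by apply: eq_bigr => q _; rewrite mcoeffD mulrDl scalerDl.
Qed.

Lemma pa_mulDr : right_distributive pa_mul +%R.
Proof.
move=> z x y.
rewrite (pa_mulw (fsubset_refl _) (msuppD_le x y)).
rewrite (pa_mulw (fsubset_refl _) (fsubsetUl (msupp x) (msupp y))).
rewrite (pa_mulw (fsubset_refl _) (fsubsetUr (msupp x) (msupp y))).
rewrite -big_split; apply: eq_bigr => p _; rewrite -big_split.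
by apply: eq_bigr => q _; rewrite mcoeffD mulrDr scalerDl.
Qed.

Lemma pa_mulZl a x y : a *: pa_mul x y = pa_mul (a *: x) y.
Proof.
rewrite (pa_mulw (msuppZ_le a x) (fsubset_refl _)).
rewrite (pa_mulw (fsubset_refl (msupp x)) (fsubset_refl _)) scaler_sumr.
apply: eq_bigr => p _; rewrite scaler_sumr; apply: eq_bigr => q _.
by rewrite mcoeffZ scalerA mulrA.
Qed.

Lemma pa_mulZr a x y : a *: pa_mul x y = pa_mul x (a *: y).
Proof.
rewrite (pa_mulw (fsubset_refl _) (msuppZ_le a y)).
rewrite (pa_mulw (fsubset_refl _) (fsubset_refl (msupp y))) scaler_sumr.
apply: eq_bigr => p _; rewrite scaler_sumr; apply: eq_bigr => q _.
by rewrite mcoeffZ scalerA mulrCA.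
Qed.

Lemma pa_mul0l x : pa_mul 0 x = 0.
Proof. by have := pa_mulZl 0 0 x; rewrite !scale0r. Qed.

Lemma pa_mul0r x : pa_mul x 0 = 0.
Proof. by have := pa_mulZr 0 x 0; rewrite !scale0r. Qed.

Lemma pa_mulsuml (I : Type) (s : seq I) (P : pred I) (F : I -> kQ) y :
  pa_mul (\sum_(i <- s | P i) F i) y = \sum_(i <- s | P i) pa_mul (F i) y.
Proof.
by rewrite (big_morph (pa_mul^~ y) (fun a b => pa_mulDl a b y) (pa_mul0l y)).
Qed.

Lemma pa_mulsumr (I : Type) (s : seq I) (P : pred I) (F : I -> kQ) x :
  pa_mul x (\sum_(i <- s | P i) F i) = \sum_(i <- s | P i) pa_mul x (F i).
Proof. by rewrite (big_morph (pa_mul x) (pa_mulDr x) (pa_mul0r x)). Qed.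

Lemma pa_mulpathE p q : pa_mul (pa_path p) (pa_path q) = pa_mulpath p q.
Proof.
rewrite !pa_pathE (pa_mulw msuppU_le msuppU_le) !big_seq_fset1 !mcoeffUU.
by rewrite mulr1 scale1r.
Qed.

Lemma pa_expand x : x = \sum_(p <- msupp x) mcoeff p x *: pa_path p.
Proof.
rewrite [LHS]monalgE; apply: eq_bigr => p _; apply/malgP => q.
by rewrite [RHS]mcoeffZ pa_pathE [LHS]mcoeffU (mcoeffU p) mulrnAr mulr1.
Qed.

Lemma pa_ind (P : kQ -> Prop) :
  P 0 -> (forall x y, P x -> P y -> P (x + y)) ->
  (forall a x, P x -> P (a *: x)) -> (forall p, P (pa_path p)) ->
  forall x, P x.
Proof.
move=> P0 PD PZ Pp x; rewrite (pa_expand x).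
by apply: (big_ind P) => // p _; apply/PZ/Pp.
Qed.

Lemma pa_mulA : associative pa_mul.
Proof.
apply: (bilinear_assoc pa_mulDl pa_mulDr pa_mulZl pa_mulZr pa_ind) => p q r.
rewrite !pa_mulpathE /pa_mulpath; case: ifPn => [cqr|ncqr].
  rewrite pa_mulpathE /pa_mulpath.
  have -> : pcomposable p (pcat q r) = pcomposable p q.
    by rewrite /pcomposable psource_cat.
  case: ifPn => [cpq|_]; last by rewrite pa_mul0l.
  rewrite pa_mulpathE /pa_mulpath {1}/pcomposable ptarget_cat //.
  by rewrite -/(pcomposable q r) cqr pcatA.
rewrite pa_mul0r; case: ifPn => [cpq|_]; last by rewrite pa_mul0l.
rewrite pa_mulpathE /pa_mulpath {1}/pcomposable ptarget_cat //.
by rewrite -/(pcomposable q r) (negPf ncqr).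
Qed.

Lemma pa_mul1l : left_id pa_one pa_mul.
Proof.
elim/pa_ind => [|x1 x2 e1 e2|a x e|p]; first exact: pa_mul0r.
- by rewrite pa_mulDr e1 e2.
- by rewrite -pa_mulZr e.
rewrite pa_mulsuml (bigD1 (psource p)) //= big1 => [|v vp].
  by rewrite addr0 pa_mulpathE /pa_mulpath /pcomposable eqxx pcat1p.
by rewrite pa_mulpathE /pa_mulpath /pcomposable /ptarget /= (negPf vp).
Qed.

Lemma pa_mul1r : right_id pa_one pa_mul.
Proof.
elim/pa_ind => [|x1 x2 e1 e2|a x e|p]; first exact: pa_mul0l.
- by rewrite pa_mulDl e1 e2.
- by rewrite -pa_mulZl e.
rewrite pa_mulsumr (bigD1 (ptarget p)) //= big1 => [|v vp].
  by rewrite addr0 pa_mulpathE /pa_mulpath /pcomposable eqxx pcatp1.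
by rewrite pa_mulpathE /pa_mulpath /pcomposable eq_sym (negPf vp).
Qed.

Lemma pa_one_coef v : mcoeff (ptriv v) pa_one = 1.
Proof.
rewrite /pa_one raddf_sum (bigD1 v) //= pa_pathE mcoeffUU.
rewrite big1 ?addr0 // => w wv; rewrite pa_pathE mcoeffU; case: eqP => // /(congr1 (@psource Q)) E.
by rewrite -[w]/(psource (ptriv w)) E eqxx in wv.
Qed.

Lemma pa_one_neq0 : pa_one != 0.
Proof.
apply/eqP => /(congr1 (mcoeff (ptriv (qpoint Q)))) /eqP.
by rewrite pa_one_coef mcoeff0 oner_eq0.
Qed.

HB.instance Definition _ := GRing.Zmodule_isNzRing.Build kQ
  pa_mulA pa_mul1l pa_mul1r pa_mulDl pa_mulDr pa_one_neq0.
HB.instance Definition _ := GRing.Lmodule_isLalgebra.Build k kQ pa_mulZl.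
HB.instance Definition _ := GRing.Lalgebra_isAlgebra.Build k kQ pa_mulZr.

Lemma pa_coef_trivM v x y :
  mcoeff (ptriv v) (x * y) = mcoeff (ptriv v) x * mcoeff (ptriv v) y.
Proof.
have E p q : mcoeff (ptriv v) (pa_mulpath p q)
             = ((p == ptriv v) && (q == ptriv v))%:R :> k.
  rewrite /pa_mulpath; have [cpq|ncpq] := ifPn; last first.
    rewrite mcoeff0; case: eqP => // pE; case: eqP => // qE.
    by rewrite pE qE /pcomposable eqxx in ncpq.
  rewrite pa_pathE mcoeffU; congr ((nat_of_bool _)%:R).
  apply/eqP/andP => [/(congr1 val)|[/eqP-> /eqP->]]; last by rewrite pcatp1.
  rewrite (val_pcat cpq) => -[sp /eqP]; rewrite -size_eq0 size_cat addn_eq0.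
  move=> /andP[/nilP ap /nilP aq].
  move/eqP: cpq; rewrite /ptarget ap /= sp => sq.
  split; apply/eqP/val_inj.
    by rewrite [LHS]surjective_pairing -/(psource p) -/(parrows p) sp ap.
  by rewrite [LHS]surjective_pairing -/(psource q) -/(parrows q) -sq aq.
pose dx := (msupp x `|` [fset ptriv v])%fset.
pose dy := (msupp y `|` [fset ptriv v])%fset.
have -> : x * y = pa_mul x y by [].
rewrite (@pa_mulw dx dy) ?fsubsetUl // raddf_sum /=.
rewrite (big_fsetD1 (ptriv v)) /=; last by rewrite !inE eqxx orbT.
rewrite [X in _ + X]big1_fset ?addr0 => [|p]; last first.
  rewrite !inE => /andP[pv _] _; rewrite raddf_sum big1 // => q _.
  by rewrite /= mcoeffZ E (negPf pv) mulr0.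
rewrite raddf_sum (big_fsetD1 (ptriv v)) /=; last by rewrite !inE eqxx orbT.
rewrite [X in _ + X]big1_fset ?addr0 => [|q]; last first.
  by rewrite !inE => /andP[qv _] _; rewrite mcoeffZ E (negPf qv) andbF mulr0.
by rewrite mcoeffZ E eqxx mulr1.
Qed.

End PathAlgebra.

(* [inl a] is the arrow a of Q and [inr a] is the reversed arrow a*. *)
Definition double_quiver (Q : quiver) : quiver :=
  @Quiver (qvertex Q) (qarrow Q + qarrow Q)%type
    (fun b => match b with inl a => qsrc a | inr a => qtgt a end)
    (fun b => match b with inl a => qtgt a | inr a => qsrc a end)
    (qpoint Q).

Section Preprojective.
Variables (k : fieldType) (Q : quiver).
Local Notation kQ := (path_algebra k (double_quiver Q)).
Implicit Types (x y z : kQ).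

Definition pa_arrow (b : qarrow (double_quiver Q)) : kQ := pa_path k (parrow b).

(* The products a a* and a* a are cycles at the two ends of a, so that
   multiplying by trivial paths yields one relation per vertex. *)
Definition preproj_rel : kQ :=
  \sum_(a : qarrow Q) pa_arrow (inl a) * pa_arrow (inr a)
  - \sum_(a : qarrow Q) pa_arrow (inr a) * pa_arrow (inl a).

Definition in_preproj_ideal (z : kQ) : Prop :=
  exists s : seq (kQ * kQ), z = \sum_(u <- s) u.1 * preproj_rel * u.2.

Definition preproj_ideal (z : kQ) : bool := `[< in_preproj_ideal z >].

Lemma preproj_idealP z :
  reflect (in_preproj_ideal z) (z \in preproj_ideal).
Proof. exact: asboolP. Qed.

Fact preproj_ideal_zmod : zmod_closed preproj_ideal.
Proof.
split=> [|x y /preproj_idealP[s ->] /preproj_idealP[t ->]].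
  by apply/preproj_idealP; exists [::]; rewrite big_nil.
apply/preproj_idealP; exists (s ++ [seq (- u.1, u.2) | u <- t]).
rewrite big_cat big_map /=; congr (_ + _).
by rewrite -sumrN; apply: eq_bigr => u _; rewrite !mulNr.
Qed.

HB.instance Definition _ :=
  GRing.isZmodClosed.Build kQ preproj_ideal preproj_ideal_zmod.

Lemma preproj_idealMl x z : z \in preproj_ideal -> x * z \in preproj_ideal.
Proof.
move=> /preproj_idealP[s ->]; apply/preproj_idealP.
exists [seq (x * u.1, u.2) | u <- s].
by rewrite big_map mulr_sumr; apply: eq_bigr => u _; rewrite !mulrA.
Qed.

Lemma preproj_idealMr x z : z \in preproj_ideal -> z * x \in preproj_ideal.
Proof.
move=> /preproj_idealP[s ->]; apply/preproj_idealP.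
exists [seq (u.1, u.2 * x) | u <- s].
by rewrite big_map mulr_suml; apply: eq_bigr => u _; rewrite !mulrA.
Qed.

Lemma preproj_ideal1 : 1 \notin preproj_ideal.
Proof.
apply/negP => /preproj_idealP[s].
move=> /(congr1 (mcoeff (ptriv (qpoint (double_quiver Q))))).
rewrite [LHS]pa_one_coef raddf_sum /= big1 => [/eqP|u _].
  by rewrite oner_eq0.
rewrite !pa_coef_trivM; set v := ptriv _.
have arr0 b : mcoeff v (pa_arrow b) = 0.
  by rewrite [pa_arrow b]pa_pathE mcoeffU; case: eqP => // /(congr1 val) [].
have s0 (F : qarrow Q -> kQ) :
    (forall a, mcoeff v (F a) = 0) -> mcoeff v (\sum_a F a) = 0.
  by move=> F0; rewrite raddf_sum big1 // => a _; exact: F0.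
have -> : mcoeff v preproj_rel = 0.
  rewrite [LHS]raddfB; set r1 := (X in X - _); set r2 := (X in _ - X).
  have -> : r1 = 0 by apply: s0 => a; rewrite pa_coef_trivM !arr0 mul0r.
  have -> : r2 = 0 by apply: s0 => a; rewrite pa_coef_trivM !arr0 mul0r.
  by rewrite subr0.
by rewrite mulr0 mul0r.
Qed.

Definition preproj :=
  Quotient.quot (GRing.ZmodClosed.clone kQ preproj_ideal _).

HB.instance Definition _ := GRing.Zmodule.on preproj.

Definition preproj_pi : kQ -> preproj := \pi_preproj.

Definition preproj_one : preproj := preproj_pi 1.
Definition preproj_mul (x y : preproj) : preproj :=
  preproj_pi (repr x * repr y).
Definition preproj_scale (a : k) (x : preproj) : preproj :=
  preproj_pi (a *: repr x).

Lemma preproj_piP x y :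
  reflect (preproj_pi x = preproj_pi y) (x - y \in preproj_ideal).
Proof. by rewrite Quotient.idealrBE; apply: eqP. Qed.

Lemma preproj_piB : zmod_morphism preproj_pi.
Proof. exact: pi_is_zmod_morphism. Qed.

Lemma preproj_piD : {morph preproj_pi : x y / x + y}.
Proof. exact: Quotient.pi_add. Qed.

Lemma preproj_reprK : cancel repr preproj_pi.
Proof. exact: reprK. Qed.

Lemma preproj_piM x y :
  preproj_pi (x * y) = preproj_mul (preproj_pi x) (preproj_pi y).
Proof.
apply/preproj_piP; set x' := repr _; set y' := repr _.
have -> : x * y - x' * y' = x * (y - y') + (x - x') * y'.
  by rewrite mulrBr mulrBl addrA subrK.
apply: rpredD; [apply: preproj_idealMl|apply: preproj_idealMr];
  by apply/preproj_piP; rewrite preproj_reprK.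
Qed.

Lemma preproj_piZ a x : preproj_pi (a *: x) = preproj_scale a (preproj_pi x).
Proof.
apply/preproj_piP; rewrite -scalerBr -mulr_algl; apply: preproj_idealMl.
by apply/preproj_piP; rewrite preproj_reprK.
Qed.

Fact preproj_mulA : associative preproj_mul.
Proof.
move=> x y z; rewrite -[x]preproj_reprK -[y]preproj_reprK -[z]preproj_reprK.
by rewrite -!preproj_piM mulrA.
Qed.

Fact preproj_mul1l : left_id preproj_one preproj_mul.
Proof. by move=> x; rewrite -[x]preproj_reprK -preproj_piM mul1r. Qed.

Fact preproj_mul1r : right_id preproj_one preproj_mul.
Proof. by move=> x; rewrite -[x]preproj_reprK -preproj_piM mulr1. Qed.

Fact preproj_mulDl : left_distributive preproj_mul +%R.
Proof.
move=> x y z; rewrite -[x]preproj_reprK -[y]preproj_reprK -[z]preproj_reprK.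
by rewrite -preproj_piD -!preproj_piM -preproj_piD mulrDl.
Qed.

Fact preproj_mulDr : right_distributive preproj_mul +%R.
Proof.
move=> x y z; rewrite -[x]preproj_reprK -[y]preproj_reprK -[z]preproj_reprK.
by rewrite -preproj_piD -!preproj_piM -preproj_piD mulrDr.
Qed.

Fact preproj_one_neq0 : preproj_one != 0.
Proof.
have -> : 0 = preproj_pi 0 by have := preproj_piB 0 0; rewrite !subrr => ->.
apply/eqP => /preproj_piP; rewrite subr0.
exact/negP/preproj_ideal1.
Qed.

HB.instance Definition _ := GRing.Zmodule_isNzRing.Build preproj
  preproj_mulA preproj_mul1l preproj_mul1r preproj_mulDl preproj_mulDr
  preproj_one_neq0.

Fact preproj_scaleA a b (x : preproj) :
  preproj_scale a (preproj_scale b x) = preproj_scale (a * b) x.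
Proof. by rewrite -[x]preproj_reprK -!preproj_piZ scalerA. Qed.

Fact preproj_scale1 : left_id 1 preproj_scale.
Proof. by move=> x; rewrite -[x]preproj_reprK -preproj_piZ scale1r. Qed.

Fact preproj_scaleDr : right_distributive preproj_scale +%R.
Proof.
move=> a x y; rewrite -[x]preproj_reprK -[y]preproj_reprK.
by rewrite -preproj_piD -!preproj_piZ -preproj_piD scalerDr.
Qed.

Fact preproj_scaleDl (x : preproj) : {morph preproj_scale^~ x : a b / a + b}.
Proof.
by move=> a b; rewrite -[x]preproj_reprK -!preproj_piZ -preproj_piD scalerDl.
Qed.

HB.instance Definition _ := GRing.Zmodule_isLmodule.Build k preproj
  preproj_scaleA preproj_scale1 preproj_scaleDr preproj_scaleDl.

Fact preproj_scaleAl a (x y : preproj) : a *: (x * y) = (a *: x) * y.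
Proof.
rewrite -[x]preproj_reprK -[y]preproj_reprK.
have sE b z : b *: preproj_pi z = preproj_pi (b *: z) by rewrite preproj_piZ.
have mE u v : preproj_pi u * preproj_pi v = preproj_pi (u * v).
  by rewrite preproj_piM.
by rewrite mE !sE mE scalerAl.
Qed.

HB.instance Definition _ :=
  GRing.Lmodule_isLalgebra.Build k preproj preproj_scaleAl.

Fact preproj_scaleAr a (x y : preproj) : a *: (x * y) = x * (a *: y).
Proof.
rewrite -[x]preproj_reprK -[y]preproj_reprK.
have sE b z : b *: preproj_pi z = preproj_pi (b *: z) by rewrite preproj_piZ.
have mE u v : preproj_pi u * preproj_pi v = preproj_pi (u * v).
  by rewrite preproj_piM.
by rewrite mE !sE mE scalerAr.
Qed.

HB.instance Definition _ :=
  GRing.Lalgebra_isAlgebra.Build k preproj preproj_scaleAr.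

HB.instance Definition _ :=
  GRing.isZmodMorphism.Build kQ preproj preproj_pi preproj_piB.
HB.instance Definition _ :=
  GRing.isMonoidMorphism.Build kQ preproj preproj_pi
    (conj (erefl : preproj_pi 1 = 1) preproj_piM).
HB.instance Definition _ :=
  GRing.isScalable.Build k kQ preproj *:%R preproj_pi preproj_piZ.

Definition pp_vertex (v : qvertex Q) : preproj :=
  preproj_pi (pa_path k (@ptriv (double_quiver Q) v)).
Definition pp_arrow (b : qarrow Q + qarrow Q) : preproj :=
  preproj_pi (pa_arrow b).

Definition pa_homogeneous (s : nat) : set kQ :=
  [set x | forall p, p \in msupp x -> plength p = s].

Definition pp_graded (s : nat) : set preproj :=
  [set preproj_pi x | x in pa_homogeneous s].

Definition pp_vertex_graded (j : qvertex Q) (s : nat) : set preproj :=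
  [set pp_vertex j * x | x in pp_graded s].

End Preprojective.

Section Trace.
Variables (k : fieldType) (W : lmodType k).

Definition is_basis (V : set W) (m : nat) (b : 'I_m -> W) : Prop :=
  (forall c : 'I_m -> k, \sum_i c i *: b i = 0 -> forall i, c i = 0) /\
  V = [set w | exists c : 'I_m -> k, w = \sum_i c i *: b i].

(* t is the trace, in some finite basis, of the restriction to the subspace V
   of f, which has to map V to itself. *)
Definition is_trace (f : W -> W) (V : set W) (t : k) : Prop :=
  exists (m : nat) (b : 'I_m -> W) (B : 'M[k]_m),
    [/\ is_basis V b, forall i, f (b i) = \sum_j B i j *: b j & t = \tr B].

Lemma is_trace_unique (f : {linear W -> W}) (V : set W) (t t' : k) :
  is_trace f V t -> is_trace f V t' -> t = t'.
Proof.
move=> [m [b [B [[fb Vb] fB ->]]]] [m' [b' [B' [[fb' Vb'] fB' ->]]]].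
have inV n (c : 'I_n -> W) : is_basis V c -> forall i, V (c i).
  move=> [_ ->] i; exists (fun j => (i == j)%:R).
  rewrite (bigD1 i) //= eqxx scale1r big1 ?addr0 // => j ji.
  by rewrite eq_sym (negPf ji) scale0r.
have /choice[P PE] : forall i, exists c : 'I_m' -> k, b i = \sum_j c j *: b' j.
  by move=> i; have := inV _ _ (conj fb Vb) i; rewrite Vb'.
have /choice[R RE] : forall i, exists c : 'I_m -> k, b' i = \sum_j c j *: b j.
  by move=> i; have := inV _ _ (conj fb' Vb') i; rewrite {1}Vb.
pose MP := \matrix_(i, j) P i j; pose MR := \matrix_(i, j) R i j.
have exch n1 n2 (C : 'I_n1 -> k) (D : 'I_n1 -> 'I_n2 -> k) (c : 'I_n2 -> W) :
    \sum_i C i *: (\sum_j D i j *: c j) = \sum_j (\sum_i C i * D i j) *: c j.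
  under eq_bigr do rewrite scaler_sumr.
  rewrite exchange_big; apply: eq_bigr => j _; rewrite scaler_suml.
  by apply: eq_bigr => i _; rewrite scalerA.
have inj n (c : 'I_n -> W) : is_basis V c -> forall C D : 'I_n -> k,
    \sum_i C i *: c i = \sum_i D i *: c i -> forall i, C i = D i.
  move=> [fc _] C D E i; apply/eqP; rewrite -subr_eq0; apply/eqP.
  apply: (fc (fun i => C i - D i)); under eq_bigr do rewrite scalerBl.
  by rewrite sumrB E subrr.
have RP : MR *m MP = 1%:M.
  apply/matrixP => i j; rewrite !mxE; under eq_bigr do rewrite !mxE.
  apply: (inj _ _ (conj fb' Vb') (fun j => \sum_l R i l * P l j)
            (fun j => (i == j)%:R)).
  rewrite -exch; under eq_bigr do rewrite -PE.
  rewrite -RE (bigD1 i) //= eqxx scale1r big1 ?addr0 // => l li.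
  by rewrite eq_sym (negPf li) scale0r.
have BP : B *m MP = MP *m B'.
  apply/matrixP => i j; rewrite !mxE.
  under eq_bigr do rewrite !mxE.
  under [RHS]eq_bigr do rewrite !mxE.
  apply: (inj _ _ (conj fb' Vb') (fun j => \sum_l B i l * P l j)
            (fun j => \sum_l P i l * B' l j)).
  rewrite -!exch; under eq_bigr do rewrite -PE.
  rewrite -fB PE linear_sum; apply: eq_bigr => l _.
  by rewrite linearZ /= fB'.
have PR : MP *m MR = 1%:M.
  apply/matrixP => i j; rewrite !mxE; under eq_bigr do rewrite !mxE.
  apply: (inj _ _ (conj fb Vb) (fun j => \sum_l P i l * R l j)
            (fun j => (i == j)%:R)).
  rewrite -exch; under eq_bigr do rewrite -RE.
  rewrite -PE (bigD1 i) //= eqxx scale1r big1 ?addr0 // => l li.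
  by rewrite eq_sym (negPf li) scale0r.
by rewrite -[B]mulmx1 -PR mulmxA BP -mulmxA mxtrace_mulC -mulmxA RP mulmx1.
Qed.

(* The trace of f on V, with the conventional value 0 if V is not a
   finite-dimensional subspace stable under f. *)
Definition trace_on (f : W -> W) (V : set W) : k := xget 0 (is_trace f V).

End Trace.

Record fps (R : comNzRingType) := FPS { fps_coef :> nat -> R }.

Section FPS.
Variable R : comNzRingType.
Implicit Types f g h : fps R.

HB.instance Definition _ := gen_eqMixin (fps R).
HB.instance Definition _ := gen_choiceMixin (fps R).

Lemma fpsP f g : f =1 g -> f = g.
Proof. by case: f g => [f] [g] /= /funext ->. Qed.

Definition fps_zero : fps R := FPS (fun=> 0).
Definition fps_opp f : fps R := FPS (fun n => - f n).
Definition fps_add f g : fps R := FPS (fun n => f n + g n).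
Definition fps_one : fps R := FPS (fun n => (n == 0)%:R).
Definition fps_mul f g : fps R := FPS (fun n => \sum_(i < n.+1) f i * g (n - i)%N).

Fact fps_addA : associative fps_add.
Proof. by move=> f g h; apply: fpsP => n /=; rewrite addrA. Qed.
Fact fps_addC : commutative fps_add.
Proof. by move=> f g; apply: fpsP => n /=; rewrite addrC. Qed.
Fact fps_add0 : left_id fps_zero fps_add.
Proof. by move=> f; apply: fpsP => n /=; rewrite add0r. Qed.
Fact fps_addN : left_inverse fps_zero fps_opp fps_add.
Proof. by move=> f; apply: fpsP => n /=; rewrite addNr. Qed.

HB.instance Definition _ :=
  GRing.isZmodule.Build (fps R) fps_addA fps_addC fps_add0 fps_addN.

Let trunc (N : nat) f : {poly R} := \poly_(i < N) f i.

Let fps_mul_trunc N f g n :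
  (n < N)%N -> fps_mul f g n = (trunc N f * trunc N g)`_n.
Proof.
move=> nN; rewrite coefM; apply: eq_bigr => -[i /= iN] _; rewrite !coef_poly.
by rewrite (leq_trans iN nN) (leq_ltn_trans (leq_subr _ _) nN).
Qed.

Fact fps_mulA : associative fps_mul.
Proof.
move=> f g h; apply: fpsP => n; rewrite !(@fps_mul_trunc n.+1) //.
transitivity ((trunc n.+1 f * (trunc n.+1 g * trunc n.+1 h))`_n).
  rewrite !coefM; apply: eq_bigr => i _; congr (_ * _).
  by rewrite coef_poly ltnS leq_subr (@fps_mul_trunc n.+1) // ltnS leq_subr.
rewrite mulrA !coefM; apply: eq_bigr => i _; congr (_ * _).
by rewrite [RHS]coef_poly ltn_ord (@fps_mul_trunc n.+1).
Qed.

Fact fps_mulC : commutative fps_mul.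
Proof.
by move=> f g; apply: fpsP => n; rewrite !(@fps_mul_trunc n.+1) // mulrC.
Qed.

Fact fps_mul1 : left_id fps_one fps_mul.
Proof.
move=> f; apply: fpsP => n /=.
by rewrite big_ord_recl /= mul1r subn0 big1 ?addr0 // => i _; rewrite mul0r.
Qed.

Fact fps_mulDl : left_distributive fps_mul +%R.
Proof.
move=> f g h; apply: fpsP => n /=; rewrite -big_split.
by apply: eq_bigr => i _; rewrite mulrDl.
Qed.

Fact fps_one_neq0 : fps_one != 0.
Proof.
by apply/eqP => /(congr1 (fun f : fps R => f 0)) /eqP; rewrite /= oner_eq0.
Qed.

HB.instance Definition _ := GRing.Zmodule_isComNzRing.Build (fps R)
  fps_mulA fps_mulC fps_mul1 fps_mulDl fps_one_neq0.

Definition fps_unit : pred (fps R) := fun f => `[< exists g, g * f = 1 >].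
Definition fps_inv f : fps R := xget f [set g | g * f = 1].

Fact fps_mulV : {in fps_unit, left_inverse 1 fps_inv *%R}.
Proof.
move=> f /asboolP[g gf]; rewrite /fps_inv.
by case: xgetP => [h _ //|/(_ g) /=].
Qed.

Fact fps_unitP f g : g * f = 1 -> fps_unit f.
Proof. by move=> gf; apply/asboolP; exists g. Qed.

Fact fps_inv_out : {in [predC fps_unit], fps_inv =1 id}.
Proof.
move=> f; rewrite inE => /asboolP nf; rewrite /fps_inv.
by case: xgetP => // g _ gf; case: nf; exists g.
Qed.

HB.instance Definition _ := GRing.ComNzRing_hasMulInverse.Build (fps R)
  fps_mulV fps_unitP fps_inv_out.

Definition poly_fps (p : {poly R}) : fps R := FPS (fun n => p`_n).

End FPS.

(* Vertices and arrows are numbered 0, ..., n - 1 instead of 1, ..., n, and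
   [ordS] is the cyclic successor on ['I_n]. *)
Definition first_vertex (n : nat) (hn : (3 <= n)%N) : 'I_n :=
  Ordinal (ltnW (ltnW hn)).

Definition cyclic_quiver (n : nat) (hn : (3 <= n)%N) : quiver :=
  @Quiver 'I_n 'I_n id (@ordS n) (first_vertex hn).

Definition cyclic_preproj (k : fieldType) (n : nat) (hn : (3 <= n)%N) :=
  preproj k (cyclic_quiver hn).

HB.instance Definition _ (k : fieldType) (n : nat) (hn : (3 <= n)%N) :=
  GRing.Algebra.on (cyclic_preproj k hn).

Section CyclicPreprojective.
Variables (k : fieldType) (n : nat) (hn : (3 <= n)%N).
Local Notation A := (cyclic_preproj k hn).

Definition ee (i : 'I_n) : A := pp_vertex k (i : qvertex (cyclic_quiver hn)).
Definition alpha (i : 'I_n) : A :=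
  pp_arrow k (inl (i : qarrow (cyclic_quiver hn))).
Definition alpha_star (i : 'I_n) : A :=
  pp_arrow k (inr (i : qarrow (cyclic_quiver hn))).

Definition graded_piece (s : nat) : set A := pp_graded s.

Definition vector_trace (g : A -> A) : 'cV[fps k]_n :=
  \col_j FPS (fun s => trace_on g
    (pp_vertex_graded (j : qvertex (cyclic_quiver hn)) s)).

(* The entries with index pairs (1, n) and (n, 1) of the 1-based description are
   covered by the cyclic successor; the three branches are disjoint as n >= 3. *)
Definition trace_matrix (c t : 'I_n -> k) : 'M[{poly k}]_n :=
  \matrix_(i, j)
    if j == i then 1 + (c (first_vertex hn) * t (first_vertex hn)) *: 'X^2
    else if j == ordS i then - (c i *: 'X)
    else if i == ordS j then - (t j *: 'X)
    else 0.

End CyclicPreprojective.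

Arguments ee k {n} hn i.
Arguments alpha k {n} hn i.
Arguments alpha_star k {n} hn i.
Arguments graded_piece k {n} hn s.
Arguments vector_trace {k n} hn g.
Arguments trace_matrix {k n} hn c t.

(* Main.v *)
(** Every path of the double quiver is equal in A to the path with the same
    source, the same number a of arrows alpha and the same number b of arrows
    alpha*, in which the arrows alpha come first.  The source and the numbers
    a and b are invariant under the relations, so these standard paths form a
    basis, on which g acts diagonally; the eigenvalue m(j, a, b) is a product
    of scalars c_i and t_i.  Since c_i t_i = q does not depend on i,
      m(j, a + 1, b) = c_j m(j + 1, a, b),
      m(j, a, b + 1) = t_(j-1) m(j - 1, a, b),
      m(j, a + 1, b + 1) = q m(j, a, b),
    and inclusion-exclusion over a > 0 and b > 0 turns this into a linear
    system with matrix M for the generating series of m.  When the eigenvalues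
    are multiplied by the indicator of the paths that end at a vertex i, the
    same recursion produces the i-th column of the inverse of M. *)
Require Import Defs.
From HB Require Import structures.
From mathcomp Require Import all_boot all_order all_algebra.
From mathcomp Require Import finmap monalg boolp.
From mathcomp Require Import classical_sets.

Set Implicit Arguments.
Unset Strict Implicit.
Unset Printing Implicit Defensive.

Import GRing.Theory.
Local Open Scope ring_scope.
Local Open Scope classical_set_scope.

(** * Linear functionals on the path algebra prescribed by their values on paths *)

Section PathEval.
Variables (k : fieldType) (Q : quiver) (phi : qpath Q -> k).
Implicit Types x y : path_algebra k Q.

Definition path_eval (x : path_algebra k Q) : k :=
  \sum_(p <- msupp x) mcoeff p x * phi p.

Lemma path_evalw (d : {fset qpath Q}) x : (msupp x `<=` d)%fset ->
  path_eval x = \sum_(p <- d) mcoeff p x * phi p.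
Proof.
move=> le; apply: big_fset_incl => // p _ /mcoeff_outdom ->.
by rewrite mul0r.
Qed.

Lemma path_evalD x y : path_eval (x + y) = path_eval x + path_eval y.
Proof.
rewrite (path_evalw (msuppD_le x y)).
rewrite (path_evalw (fsubsetUl (msupp x) (msupp y))).
rewrite (path_evalw (fsubsetUr (msupp x) (msupp y))) -big_split.
by apply: eq_bigr => p _; rewrite mcoeffD mulrDl.
Qed.

Lemma path_evalZ a x : path_eval (a *: x) = a * path_eval x.
Proof.
rewrite (path_evalw (msuppZ_le a x)) mulr_sumr.
by apply: eq_bigr => p _; rewrite mcoeffZ mulrA.
Qed.

Lemma path_eval_path p : path_eval (pa_path k p) = phi p.
Proof.
rewrite pa_pathE (path_evalw (msuppU_le)) big_seq_fset1.
by rewrite mcoeffUU mul1r.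
Qed.

Lemma path_eval_is_scalable : scalable_for *%R path_eval.
Proof. exact: path_evalZ. Qed.

Lemma path_eval_is_zmod_morphism : zmod_morphism path_eval.
Proof.
move=> x y; rewrite path_evalD; congr (_ + _).
by rewrite -scaleN1r path_evalZ mulN1r.
Qed.

HB.instance Definition _ :=
  GRing.isZmodMorphism.Build (path_algebra k Q) k path_eval
    path_eval_is_zmod_morphism.
HB.instance Definition _ :=
  GRing.isScalable.Build k (path_algebra k Q) k *%R path_eval
    path_eval_is_scalable.

End PathEval.

Lemma pa_pathM (k : fieldType) (Q : quiver) (p q : qpath Q) :
  pa_path k p * pa_path k q =
  if pcomposable p q then pa_path k (pcat p q) else 0.
Proof. exact: pa_mulpathE. Qed.

Lemma parrows_cat (Q : quiver) (p q : qpath Q) : pcomposable p q ->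
  parrows (pcat p q) = parrows p ++ parrows q.
Proof. by move=> cpq; rewrite {1}/parrows val_pcat. Qed.

(** * Path types as invariants of the preprojective relations *)

Section CyclicWalks.
Variables (k : fieldType) (n : nat) (hn : (3 <= n)%N).
Local Notation Q := (cyclic_quiver hn).
Local Notation DQ := (double_quiver Q).
Local Notation kQ := (path_algebra k DQ).
Local Notation A := (cyclic_preproj k hn).

Definition fwd (b : qarrow DQ) : bool := if b is inl _ then true else false.

Definition path_type (p : qpath DQ) : 'I_n * nat * nat :=
  (psource p, count fwd (parrows p), count (predC fwd) (parrows p)).

Definition type_coef (u : 'I_n * nat * nat) : kQ -> k :=
  path_eval (fun p => (path_type p == u)%:R).

HB.instance Definition _ u := GRing.Linear.copy (type_coef u)
  (path_eval (fun p : qpath DQ => (path_type p == u)%:R : k)).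

(** One of [b1], [b2] is an alpha and the other an alpha*, so each count grows by one. The value
    depends on the pair only through its end vertices, hence alpha alpha* and alpha* alpha at the
    same vertex get equal values. *)
Lemma type_coef_insert u (p q : qpath DQ) (b1 b2 : qarrow DQ) :
    qtgt b1 = qsrc b2 -> fwd b2 = ~~ fwd b1 ->
  type_coef u (pa_path k p * (pa_arrow k b1 * pa_arrow k b2) * pa_path k q) =
  ((ptarget p == qsrc b1) && (psource q == qtgt b2) &&
   ((psource p, (count fwd (parrows p) + count fwd (parrows q)).+1,
     (count (predC fwd) (parrows p) + count (predC fwd) (parrows q)).+1)
     == u :> 'I_n * nat * nat))%:R.
Proof.
move=> b12 f12; rewrite /type_coef /pa_arrow pa_pathM.
have c12 : pcomposable (parrow b1) (parrow b2).
  by apply/eqP; exact: b12.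
rewrite c12 pa_pathM.
have -> : pcomposable p (pcat (parrow b1) (parrow b2)) = (ptarget p == qsrc b1).
  by rewrite /pcomposable psource_cat.
case: ifPn => [cp|_]; last by rewrite mul0r linear0.
have cp' : pcomposable p (pcat (parrow b1) (parrow b2)).
  by rewrite /pcomposable psource_cat.
rewrite pa_pathM.
have -> : pcomposable (pcat p (pcat (parrow b1) (parrow b2))) q
          = (psource q == qtgt b2).
  by rewrite /pcomposable !ptarget_cat // eq_sym.
case: ifPn => [cq|_]; last by rewrite linear0.
have cq' : pcomposable (pcat p (pcat (parrow b1) (parrow b2))) q.
  by rewrite /pcomposable !ptarget_cat // eq_sym.
rewrite path_eval_path /path_type !psource_cat // !parrows_cat // !count_cat.
by case: b1 b2 f12 {b12 c12 cp cp' cq cq'} => i [] j //= _;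
   rewrite ?add0n ?add1n ?addn0 ?addn1 ?addSn ?addnS.
Qed.

Lemma type_coef_ideal u (z : kQ) : in_preproj_ideal z -> type_coef u z = 0.
Proof.
(* By bilinearity the outer factors may be taken to be paths. *)
suff E r : (forall p q, type_coef u (pa_path k p * r * pa_path k q) = 0) ->
    forall x y, type_coef u (x * r * y) = 0.
  move=> [s ->]; rewrite linear_sum big1 // => -[x y] _; apply: E => p q.
  rewrite /preproj_rel mulrBr mulrBl linearB /= !mulr_sumr !mulr_suml.
  rewrite !linear_sum; apply/eqP; rewrite subr_eq0; apply/eqP.
  (* alpha_i* alpha_i is a cycle at i + 1, so it is matched with alpha_(i+1) alpha_(i+1)*. *)
  rewrite (reindex_inj (@ordS_inj n)).
  apply: eq_bigr => i _.
  by rewrite /= type_coef_insert // type_coef_insert.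
move=> rE x y.
elim/pa_ind: x => [|x1 x2 e1 e2|a x e|p]; first by rewrite !mul0r linear0.
- by rewrite !mulrDl linearD /= e1 e2 addr0.
- by rewrite -!scalerAl linearZ /= e mulr0.
elim/pa_ind: y => [|y1 y2 e1 e2|a y e|q]; first by rewrite !mulr0 linear0.
- by rewrite !mulrDr linearD /= e1 e2 addr0.
- by rewrite -!scalerAr linearZ /= e mulr0.
exact: rE.
Qed.

Lemma type_coef_repr u (x : kQ) :
  type_coef u (repr (preproj_pi x)) = type_coef u x.
Proof.
apply/eqP; rewrite -subr_eq0 -linearB; apply/eqP/type_coef_ideal.
by apply/preproj_idealP/preproj_piP; rewrite preproj_reprK.
Qed.


(** Independent of the representative, since [type_coef u] kills the ideal; a coordinate function on
    A. *)
Definition pp_coef u (x : A) : k := type_coef u (repr x).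

Lemma pp_coef_pi u (x : kQ) : pp_coef u (preproj_pi x) = type_coef u x.
Proof. exact: type_coef_repr. Qed.

Lemma pp_coefD u (x y : A) : pp_coef u (x + y) = pp_coef u x + pp_coef u y.
Proof.
rewrite -[x]preproj_reprK -[y]preproj_reprK -[X in pp_coef u X]preproj_piD.
by rewrite !pp_coef_pi linearD.
Qed.

Lemma pp_coefZ u a (x : A) : pp_coef u (a *: x) = a * pp_coef u x.
Proof.
rewrite -[x]preproj_reprK -[X in pp_coef u X]preproj_piZ.
by rewrite !pp_coef_pi linearZ.
Qed.

Lemma pp_coef_is_zmod_morphism u : zmod_morphism (pp_coef u).
Proof.
by move=> x y; rewrite pp_coefD -scaleN1r pp_coefZ mulN1r.
Qed.

HB.instance Definition _ u :=
  GRing.isZmodMorphism.Build A k (pp_coef u) (pp_coef_is_zmod_morphism u).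
HB.instance Definition _ u :=
  GRing.isScalable.Build k A k *%R (pp_coef u) (pp_coefZ u).

(** * Standard paths and the basis of e_j A_s *)

Fixpoint standard_star (j : 'I_n) (b : nat) : A :=
  if b is b'.+1 then
    alpha_star k hn (ord_pred j) * standard_star (ord_pred j) b'
  else ee k hn j.

Fixpoint standard (j : 'I_n) (a b : nat) : A :=
  if a is a'.+1 then alpha k hn j * standard (ordS j) a' b
  else standard_star j b.

Lemma pp_arrow_vertex (b : qarrow DQ) v :
  pp_arrow k b * pp_vertex k v = (if qtgt b == v then pp_arrow k b else 0) :> A.
Proof.
rewrite -[LHS]preproj_piM /pa_arrow pa_pathM /pcomposable.
rewrite -[ptarget _]/(qtgt b) -[psource _]/v; case: eqP => [E|_].
  by rewrite pcatp1.
by rewrite [LHS]linear0.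
Qed.

(** Multiplying the single relation on the right by [ee k hn j] keeps only the cycles at j, one from
    each sum. *)
Lemma alpha_star_alpha (j : 'I_n) :
  alpha_star k hn (ord_pred j) * alpha k hn (ord_pred j)
  = alpha k hn j * alpha_star k hn j.
Proof.
have /eqP : preproj_pi (preproj_rel k Q) = 0 :> A.
  rewrite -[RHS](linear0 (@preproj_pi k Q)); apply/preproj_piP.
  rewrite subr0; apply/preproj_idealP; exists [:: (1, 1)].
  by rewrite big_seq1 mul1r mulr1.
rewrite /preproj_rel [X in X == _]linearB subr_eq0 !linear_sum => /eqP.
move=> /(congr1 (fun x : A => x * ee k hn j)).
rewrite /= !mulr_suml.
have E (b1 b2 : 'I_n -> qarrow DQ) (i0 : 'I_n) (r : 'I_n -> 'I_n) :
    (forall i, qtgt (b2 i) = r i :> 'I_n) ->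
    (forall i, (r i == j) = (i == i0)) ->
    \sum_i (preproj_pi (pa_arrow k (b1 i) * pa_arrow k (b2 i)) : A) * ee k hn j
      = pp_arrow k (b1 i0) * pp_arrow k (b2 i0).
  move=> rE jE; under eq_bigr => i _ do
    rewrite (preproj_piM _ _ : preproj_pi _ = pp_arrow k _ * pp_arrow k _)
            -mulrA pp_arrow_vertex rE jE.
  by rewrite (bigD1 i0) //= eqxx big1 ?addr0 // => i /negPf ->; rewrite mulr0.
rewrite (E _ _ j id) // (E _ _ (ord_pred j) (@ordS n)) // => i.
by rewrite (can2_eq (@ordSK n) (@ord_predK n)).
Qed.

(** A leading alpha* is moved past each alpha by [alpha_star_alpha] until it joins the other arrows
    alpha*. *)
Lemma alpha_star_standard (j : 'I_n) a b :
  alpha_star k hn (ord_pred j) * standard (ord_pred j) a b = standard j a b.+1.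
Proof.
elim: a j => // a IH j /=.
by rewrite mulrA ord_predK alpha_star_alpha -mulrA -[in RHS]IH ordSK.
Qed.

Lemma path_standard (v : 'I_n) s (p : qpath DQ) : val p = (v, s) ->
  preproj_pi (pa_path k p) = standard v (count fwd s) (count (predC fwd) s).
Proof.
elim: s v p => [|b s IH] v p pE.
  have -> : p = @ptriv DQ v by apply: val_inj.
  by [].
have := valP p; rewrite pE /= => /andP[/eqP bv ws].
pose q : qpath DQ := exist (fun p => is_walk p.1 p.2) (qtgt b, s) ws.
have pq : pcomposable (parrow b) q by exact: eqxx.
have -> : p = pcat (parrow b) q.
  by apply: val_inj; rewrite val_pcat // pE -bv.
have := pa_pathM k (parrow b) q; rewrite pq => <-.
rewrite [LHS]preproj_piM (IH (qtgt b) q) // -bv.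
case: b bv {pq pE ws q} => i bv //=; rewrite -?/(alpha _ _ _) add0n.
by rewrite add1n -alpha_star_standard ordSK.
Qed.

(** Provides lifts of the standard elements to the path algebra, where types and lengths can be
    computed. *)
Lemma standard_path (j : 'I_n) a b :
  exists p : qpath DQ, path_type p = (j, a, b).
Proof.
suff [s [ws <- <-]] : exists s : seq (qarrow DQ),
    [/\ is_walk (j : qvertex DQ) s, count fwd s = a & count (predC fwd) s = b].
  by exists (exist (fun p => is_walk p.1 p.2) (j : qvertex DQ, s) ws).
elim: a j => [|a IH] j; last first.
  have [s [ws sa sb]] := IH (ordS j).
  by exists ((inl j : qarrow DQ) :: s); rewrite /= eqxx sa sb.
elim: b j => [|b IH] j; first by exists [::].
have [s [ws sa sb]] := IH (ord_pred j).
exists ((inr (ord_pred j) : qarrow DQ) :: s).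
by rewrite /= ord_predK eqxx sa sb.
Qed.

Lemma path_type_standard (p : qpath DQ) j a b : path_type p = (j, a, b) ->
  preproj_pi (pa_path k p) = standard j a b.
Proof.
by case=> <- <- <-; apply: path_standard; rewrite [LHS]surjective_pairing.
Qed.

(** Duality with the type functionals, the source of linear independence. *)
Lemma pp_coef_standard u j a b :
  pp_coef u (standard j a b) = (u == (j, a, b))%:R.
Proof.
have [p pE] := standard_path j a b.
by rewrite -(path_type_standard pE) pp_coef_pi [LHS]path_eval_path pE eq_sym.
Qed.

Lemma standard_neq0 j a b : standard j a b != 0.
Proof.
apply/eqP => /(congr1 (pp_coef (j, a, b)))/eqP.
by rewrite pp_coef_standard eqxx linear0 oner_eq0.
Qed.

Lemma vertex_path v (p : qpath DQ) :
  pp_vertex k v * preproj_pi (pa_path k p)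
  = (if psource p == v then preproj_pi (pa_path k p) else 0) :> A.
Proof.
rewrite -[LHS]preproj_piM pa_pathM /pcomposable.
rewrite -[ptarget _]/v eq_sym; case: eqP => [E|_]; first by rewrite pcat1p.
by rewrite [LHS]linear0.
Qed.

Lemma pa_homogeneousD s (x y : kQ) :
  pa_homogeneous s x -> pa_homogeneous s y -> pa_homogeneous s (x + y).
Proof.
move=> hx hy p /(fsubsetP (msuppD_le x y)).
by rewrite in_fsetU => /orP[/hx|/hy].
Qed.

Lemma pa_homogeneousZ s a (x : kQ) :
  pa_homogeneous s x -> pa_homogeneous s (a *: x).
Proof. by move=> hx p /(fsubsetP (msuppZ_le a x)) /hx. Qed.

Lemma pa_homogeneous0 s : pa_homogeneous s (0 : kQ).
Proof. by move=> p; rewrite msupp0. Qed.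

Lemma pa_homogeneous_path (p : qpath DQ) :
  pa_homogeneous (plength p) (pa_path k p).
Proof.
move=> q; rewrite pa_pathE => /(fsubsetP msuppU_le).
by rewrite in_fset1 => /eqP ->.
Qed.

Lemma plength_type (p : qpath DQ) j a b :
  path_type p = (j, a, b) -> plength p = (a + b)%N.
Proof. by case=> _ <- <-; rewrite count_predC. Qed.

(** The index i counts the arrows alpha. Independence comes from the dual functionals, spanning from
    sorting each path of length s. *)
Lemma standard_basis (j : 'I_n) s :
  is_basis (@pp_vertex_graded k Q j s : set A)
    (fun i : 'I_s.+1 => standard j i (s - i)).
Proof.
split=> [x x0 i|].
  pose u := (j, i : nat, (s - i)%N).
  have : \sum_l x l * pp_coef u (standard j l (s - l)) = 0.
    rewrite -[RHS](linear0 (pp_coef u)) -[in RHS]x0.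
    by rewrite [RHS]linear_sum; apply: eq_bigr => l _; rewrite [RHS]pp_coefZ.
  rewrite (bigD1 i) //= pp_coef_standard eqxx mulr1 big1 ?addr0 // => l li.
  rewrite pp_coef_standard; case: eqP => [[il]|_]; last by rewrite mulr0.
  by move: li; rewrite (val_inj il : i = l) eqxx.
apply/seteqP; split=> [_ [_ [x xs <-] <-]|w [x ->]] /=.
  rewrite (pa_expand x) linear_sum mulr_sumr big_seq.
  apply: (big_ind (fun w : A => exists c, w = _)).
  - by exists (fun=> 0); rewrite big1 // => i _; rewrite scale0r.
  - move=> _ _ [c1 ->] [c2 ->]; exists (fun i => c1 i + c2 i).
    by rewrite -big_split; apply: eq_bigr => i _; rewrite scalerDl.
  move=> p /xs ps; rewrite linearZ /= -scalerAr vertex_path.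
  case: eqP => [pj|_]; last first.
    by exists (fun=> 0); rewrite scaler0 big1 // => i _; rewrite scale0r.
  have pt : path_type p = (j, (path_type p).1.2, (path_type p).2).
    by rewrite -pj.
  have pab := plength_type pt; rewrite ps in pab.
  have lt : ((path_type p).1.2 < s.+1)%N by rewrite ltnS pab leq_addr.
  (* Once sorted, the path is the basis vector indexed by its number of arrows alpha. *)
  exists (fun i => mcoeff p x * (i == Ordinal lt)%:R).
  rewrite (bigD1 (Ordinal lt)) //= eqxx mulr1 big1 ?addr0 => [|i /negPf ->].
    by rewrite (path_type_standard pt) pab addKn.
  by rewrite mulr0 scale0r.
(* For the reverse inclusion, paths lifting the basis vectors give a homogeneous preimage. *)
have /choice[p pE] : forall i : 'I_s.+1,
    exists p, path_type p = (j, i : nat, (s - i)%N).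
  by move=> i; apply: standard_path.
exists (preproj_pi (\sum_i x i *: pa_path k (p i))).
  exists (\sum_i x i *: pa_path k (p i)) => //.
  apply: (big_ind (fun x : kQ => pa_homogeneous s x)).
  - exact: pa_homogeneous0.
  - exact: pa_homogeneousD.
  move=> i _; apply: pa_homogeneousZ.
  have := @pa_homogeneous_path (p i).
  by rewrite (plength_type (pE i)) subnKC // -ltnS.
rewrite linear_sum mulr_sumr; apply: eq_bigr => i _.
rewrite linearZ /= -scalerAr vertex_path.
have -> : psource (p i) == j by case: (pE i) => ->.
by rewrite (path_type_standard (pE i)).
Qed.

End CyclicWalks.

(** * Generating series of weights and the linear system with matrix M *)

Section TraceMatrix.
Variables (k : fieldType) (n : nat) (hn : (3 <= n)%N).
Variables (c t phi : 'I_n -> k).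
Local Notation q := (c (first_vertex hn) * t (first_vertex hn)).

(** [phi] weights the end vertex: the constant 1 gives the eigenvalues of g, the indicator of a
    vertex i gives column i of the inverse matrix. *)
Fixpoint weight_star (j : 'I_n) (b : nat) : k :=
  if b is b'.+1 then t (ord_pred j) * weight_star (ord_pred j) b' else phi j.

Fixpoint weight (j : 'I_n) (a b : nat) : k :=
  if a is a'.+1 then c j * weight (ordS j) a' b else weight_star j b.

Definition weight_series (j : 'I_n) : fps k :=
  FPS (fun s => \sum_(i < s.+1) weight j i (s - i)).

Hypothesis ct : forall j, c j * t j = q.

(** Scalar counterpart of [alpha_star_standard]: since t_(j-1) c_(j-1) = c_j t_j, the scalar of an
    alpha* can be taken out first. *)
Lemma weight_starE (j : 'I_n) a b :
  weight j a b.+1 = t (ord_pred j) * weight (ord_pred j) a b.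
Proof.
elim: a j => // a IH j /=; rewrite IH ordSK ord_predK !mulrA ct.
by rewrite [t _ * c _]mulrC ct.
Qed.

Lemma poly_fpsD (p1 p2 : {poly k}) :
  poly_fps (p1 + p2) = poly_fps p1 + poly_fps p2.
Proof. by apply: fpsP => s /=; rewrite coefD. Qed.

Lemma poly_fpsZXM a m (f : fps k) s :
  (poly_fps (a *: 'X^m) * f) s = if (m <= s)%N then a * f (s - m)%N else 0.
Proof.
have -> : (poly_fps (a *: 'X^m) * f) s
    = \sum_(i < s.+1) (a *: 'X^m)`_i * f (s - i)%N by [].
case: leqP => [ms|sm].
  pose m' : 'I_s.+1 := Ordinal (ms : m < s.+1)%N.
  rewrite (bigD1 m') //= coefZ coefXn eqxx mulr1.
  rewrite big1 ?addr0 // => i /negPf im.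
  by rewrite coefZ coefXn -[_ == _]/(i == m') im mulr0 mul0r.
rewrite big1 // => i _; rewrite coefZ coefXn.
by rewrite ltn_eqF ?mulr0 ?mul0r // (leq_trans (ltn_ord i)).
Qed.

Lemma ordS_neq (i : 'I_n) : ordS i != i.
Proof.
apply/eqP => /(congr1 val) /= E.
have := ltn_ord i; rewrite leq_eqVlt => /orP[/eqP iE|lt].
  by move: E; rewrite iE modnn => E; move: hn; rewrite -iE -E.
by move: E; rewrite modn_small // => /eqP; rewrite eqn_leq ltnn.
Qed.

(** Separates the columns j - 1 and j + 1 of row j, which would coincide for n = 2. *)
Lemma ordSS_neq (i : 'I_n) : ordS (ordS i) != i.
Proof.
apply/eqP => /(congr1 val) /=.
have := ltn_ord i; rewrite leq_eqVlt => /orP[/eqP iE|lt].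
  by rewrite iE modnn modn_small 1?ltnW // => E; move: hn; rewrite -iE -E.
rewrite (modn_small lt).
move: lt; rewrite leq_eqVlt => /orP[/eqP iE|lt].
  by rewrite iE modnn => E; move: hn; rewrite -iE -E.
by rewrite modn_small // => /eqP; rewrite eqn_leq leqNgt leqnSn.
Qed.

Lemma trace_matrix_row (f : 'I_n -> fps k) (j : 'I_n) :
  \sum_l poly_fps (trace_matrix hn c t j l) * f l =
  f j + poly_fps (q *: 'X^2) * f j
  - poly_fps (c j *: 'X^1) * f (ordS j)
  - poly_fps (t (ord_pred j) *: 'X^1) * f (ord_pred j).
Proof.
have pj : ord_pred j != j.
  by rewrite -{2}[j]ord_predK eq_sym ordS_neq.
have ps : ord_pred j != ordS j.
  by rewrite -{2}[j]ord_predK eq_sym ordSS_neq.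
have poly_fpsN p : poly_fps (- p) = - poly_fps p :> fps k.
  by apply: fpsP => s; rewrite /= coefN.
rewrite (bigD1 j) //= (bigD1 (ordS j)) ?ordS_neq //=.
rewrite (bigD1 (ord_pred j)) /=; last by rewrite pj ps.
rewrite big1 ?addr0 => [|l /andP[/andP[lj ls] lp]]; last first.
  rewrite mxE (negPf lj) (negPf ls) -(can2_eq (@ord_predK n) (@ordSK n)).
  rewrite eq_sym (negPf lp); apply/fpsP => s /=.
  by rewrite big1 // => i _; rewrite coef0 mul0r.
rewrite !mxE !eqxx (negPf (ordS_neq j)) (negPf pj) (negPf ps) ord_predK eqxx.
rewrite poly_fpsD !poly_fpsN !expr1 !addrA !mulNr mulrDl.
congr (_ + _ - _ - _).
have -> : poly_fps 1 = 1 :> fps k by apply: fpsP => s; rewrite /= coef1.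
by rewrite mul1r.
Qed.

(** In degree s the row adds the weights over all a + b = s and over a, b > 0, and subtracts those
    over a > 0 and over b > 0. Only a = b = 0 survives. *)
Lemma trace_matrix_weight (j : 'I_n) :
  \sum_l poly_fps (trace_matrix hn c t j l) * weight_series l
  = poly_fps (phi j)%:P.
Proof.
rewrite trace_matrix_row; apply: fpsP => s.
have E (u v w x : fps k) r : (u + v - w - x) r = u r + v r - w r - x r by [].
have Fc r : c j * weight_series (ordS j) r
    = \sum_(i < r.+1) weight j i.+1 (r - i) by rewrite mulr_sumr.
have Ft r : t (ord_pred j) * weight_series (ord_pred j) r
    = \sum_(i < r.+1) weight j i (r - i).+1.
  by rewrite mulr_sumr; apply: eq_bigr => i _; rewrite weight_starE.
have Fq r : q * weight_series j r = \sum_(i < r.+1) weight j i.+1 (r - i).+1.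
  rewrite mulr_sumr; apply: eq_bigr => i _ /=.
  by rewrite weight_starE ordSK mulrA ct.
have recl (h : nat -> nat -> k) r : \sum_(i < r.+2) h i (r.+1 - i)%N
    = h 0%N r.+1 + \sum_(i < r.+1) h i.+1 (r - i)%N.
  by rewrite big_ord_recl.
rewrite E !poly_fpsZXM Fc Ft Fq.
have -> : poly_fps (phi j)%:P s = (phi j)%:P`_s by [].
(* Degrees 0 and 1 are separate because terms shifted by 1 or 2 vanish there. *)
rewrite coefC; case: s => [|[|s]] /=.
- by rewrite !big_ord1 /= !subr0 addr0.
- by rewrite !big_ord_recl !big_ord0 /= !addr0 addrK subrr.
rewrite !subn1 !subn2 /= (recl (weight j)) (recl (fun a b => weight j a b.+1)).
(* [x] has a = 0, [y] collects a > 0 and [z] collects a, b > 0; the sum over b > 0 is [x + z]. *)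
set x := weight j 0 _; set y := \sum_i _; set z := \sum_i _.
by rewrite opprD addrA (addrAC x y) addrK addrAC addrK subrr.
Qed.

End TraceMatrix.

Lemma trace_matrix_inverse (k : fieldType) (n : nat) (hn : (3 <= n)%N)
    (c t : 'I_n -> k) :
  (forall j, c j * t j = c (first_vertex hn) * t (first_vertex hn)) ->
  let M : 'M[fps k]_n := map_mx (@poly_fps k) (trace_matrix hn c t) in
  M \in unitmx /\
  \col_j weight_series c t (fun=> 1) j = invmx M *m const_mx 1.
Proof.
move=> ct M; have [uM _] : M \in unitmx /\
    \matrix_(j, i) weight_series c t (fun l => (l == i)%:R) j \in unitmx.
  (* With indicator weights the row identity says that the product of the two matrices is the
     identity. *)
  apply: mulmx1_unit; apply/matrixP => j i; rewrite !mxE.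
  under eq_bigr do rewrite [M _ _]mxE [X in _ * X]mxE.
  rewrite trace_matrix_weight //; apply: fpsP => s; rewrite /= coefC.
  by case: (j == i); case: s.
(* Multiplying by M reduces the claim to the row identity with [phi] constant 1. *)
split=> //; apply: (can_inj (mulKmx uM)); rewrite mulKVmx //.
apply/colP => j; rewrite !mxE.
under eq_bigr do rewrite [M _ _]mxE [X in _ * X]mxE.
by rewrite trace_matrix_weight //; apply: fpsP => s; rewrite /= coefC; case: s.
Qed.

(** * Eigenvalues and traces of g *)

Section GradedAutomorphism.
Variables (k : fieldType) (n : nat) (hn : (3 <= n)%N).
Local Notation A := (cyclic_preproj k hn).
Variables (g : {lrmorphism A -> A}) (c t : 'I_n -> k).
Hypothesis g_vertex : forall i : 'I_n, g (ee k hn i) = ee k hn i.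
Hypothesis g_alpha : forall i : 'I_n, g (alpha k hn i) = c i *: alpha k hn i.
Hypothesis g_alpha_star :
  forall i : 'I_n, g (alpha_star k hn i) = t i *: alpha_star k hn i.

(** [weight] follows the recursion of [standard], and its base value is 1 because g fixes the
    vertices. *)
Lemma standard_eigen j a b :
  g (standard k hn j a b) = weight c t (fun=> 1) j a b *: standard k hn j a b.
Proof.
elim: a j => [|a IH] j /=; last first.
  by rewrite rmorphM /= g_alpha IH -scalerAl -scalerAr scalerA.
elim: b j => [|b IH] j /=; first by rewrite g_vertex scale1r.
by rewrite rmorphM /= g_alpha_star IH -scalerAl -scalerAr scalerA.
Qed.

(* Compares two ways of computing the eigenvalue of
   alpha_i alpha_i* = alpha_(i-1)* alpha_(i-1), which is not 0. *)
Lemma arrow_scalars j : c j * t j = c (first_vertex hn) * t (first_vertex hn).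
Proof.
have step i : c i * t i = c (ord_pred i) * t (ord_pred i).
  have := standard_eigen i 1 1.
  rewrite -(alpha_star_standard k hn i 1 0) rmorphM /= g_alpha_star.
  have /= -> := standard_eigen (ord_pred i) 1 0.
  rewrite -scalerAl -scalerAr scalerA !mulr1 ordSK => /eqP.
  rewrite -subr_eq0 -scalerBl scaler_eq0.
  have /= /negPf := standard_neq0 k hn i 1 1.
  rewrite -[X in X == 0](alpha_star_standard k hn i 1 0) /= => ->.
  by rewrite orbF subr_eq0 mulrC => /eqP.
case: j; elim=> [|m IH] hm; first by congr (c _ * t _); apply: val_inj.
have <- := IH (ltnW hm); rewrite step.
by congr (c _ * t _); apply: val_inj; rewrite /= modnDr modn_small // ltnW.
Qed.

(** g is diagonal in the standard basis, so each trace is a sum of weights. *)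
Lemma vector_trace_weight :
  vector_trace hn g = \col_j weight_series c t (fun=> 1) j.
Proof.
apply/colP => j; rewrite !mxE; apply: fpsP => s /=.
have tr : is_trace g (@pp_vertex_graded k (cyclic_quiver hn) j s : set A)
    (\sum_(i < s.+1) weight c t (fun=> 1) j i (s - i)).
  exists s.+1, (fun i => standard k hn j i (s - i)).
  exists (diag_mx (\row_i weight c t (fun=> 1) j (i : 'I_s.+1) (s - i))).
  split; first exact: standard_basis.
    move=> i; rewrite standard_eigen (bigD1 i) //= !mxE eqxx mulr1n.
    rewrite big1 ?addr0 // => l li.
    by rewrite !mxE eq_sym (negPf li) mulr0n scale0r.
  by rewrite mxtrace_diag; apply: eq_bigr => i _; rewrite mxE.
(* Uniqueness identifies the chosen trace with the computed one; the default 0 is excluded since a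
   trace exists. *)
by rewrite /trace_on; case: xgetP => [x _ /(is_trace_unique tr)|/(_ _ tr)].
Qed.

End GradedAutomorphism.

Theorem mainTheorem4 (k : closedFieldType) (hk : [pchar k] =i pred0)
  (n : nat) (hn : (3 <= n)%N)
  (g : {lrmorphism cyclic_preproj k hn -> cyclic_preproj k hn})
  (g_bij : bijective g)
  (g_graded : forall s : nat,
     [set g x | x in graded_piece k hn s] = graded_piece k hn s)
  (g_vertex : forall i : 'I_n, g (ee k hn i) = ee k hn i)
  (c t : 'I_n -> k)
  (g_alpha : forall i : 'I_n, g (alpha k hn i) = c i *: alpha k hn i)
  (g_alpha_star : forall i : 'I_n,
     g (alpha_star k hn i) = t i *: alpha_star k hn i) :
  let M : 'M[fps k]_n := map_mx (@poly_fps k) (trace_matrix hn c t) in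
  M \in unitmx /\ vector_trace hn g = invmx M *m const_mx 1.
Proof.
rewrite (vector_trace_weight g_vertex g_alpha g_alpha_star).
exact: trace_matrix_inverse (arrow_scalars g_vertex g_alpha g_alpha_star).
Qed.
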